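(* Let $F$ be a field, let $V$ be a non-zero finite dimensional vector space over $F$, and let $f:V\times V\to F$ be a bilinear form. Suppose $V=V_{\mathrm{even}}$ and let $m=\dim(V)/2$. Then $L(f)$ is reductive if and only if either $f$ is indecomposable, in which case $L(f)$ is abelian of dimension $m$, or else $f_{\mathrm{even}}$ (which here equals $f$) has $m>1$ components, all of type $J_2$ (that is, $f$ has Gram matrix $J_2\oplus\cdots\oplus J_2$ with $m>1$ summands relative to some basis of $V$), in which case $L(f)\cong\mathfrak{gl}(m)$.
   Context: $L(f)=\{x\in\mathfrak{gl}(V)\mid f(xv,w)=-f(v,xw)\ \text{for all } v,w\in V\}$, a Lie subalgebra of $\mathfrak{gl}(V)$. A Lie algebra is called reductive if every solvable ideal is central. $\mathfrak{gl}(m)$ denotes the Lie algebra of all $m\times m$ matrices over $F$. A form $f$ is indecomposable if $V$ has no decomposition $V=U\oplus W$ with $f(U,W)=0=f(W,U)$ except when $U=0$ or $W=0$. $J_n$ is the $n\times n$ lower triangular Jordan block with eigenvalue $0$. In general $V$ is a direct sum of mutually orthogonal (on both sides) subspaces $U_i$ such that the restriction of $f$ to each $U_i$ is indecomposable; these restrictions are the components of $f$. $V_{\mathrm{even}}$ is the sum of those $U_i$ on which $f$ has Gram matrix $J_n$ with $n$ even, and $f_{\mathrm{even}}$ is the restriction of $f$ to $V_{\mathrm{even}}$. Thus $V=V_{\mathrm{even}}$ means that $f$ has, relative to some basis of $V$, a Gram matrix of the form $J_{2r_1}\oplus\cdots\oplus J_{2r_t}$ with all $r_i\geq 1$.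
   Formalization: The equivalence is stated except when F has characteristic 2 and m = 2; there it fails for J_2⊕J_2, since L(f)≅gl(2) is solvable and not abelian, hence not reductive. The two ''in which case'' claims are stated in every characteristic. *)

(* Defs.v *)
From HB Require Import structures.
From mathcomp Require Import all_boot all_order all_algebra.

Set Implicit Arguments.
Unset Strict Implicit.
Unset Printing Implicit Defensive.

Import GRing.Theory.
Local Open Scope ring_scope.

HB.mixin Record Vector_isLie (F : fieldType) (L : Type) of Vector F L := {
  lie : L -> L -> L;
  lie_linearl : forall y : L, linear (lie^~ y);
  lie_linearr : forall x : L, linear (lie x);
  liexx : forall x : L, lie x x = 0;
  lie_jacobi : forall x y z : L,
    lie x (lie y z) + lie y (lie z x) + lie z (lie x y) = 0
}.

#[short(type="lieType")]
HB.structure Definition Lie (F : fieldType) :=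
  {L of Vector F L & Vector_isLie F L}.

Fact jacobi_cancel (W : zmodType) (a b c d e g : W) :
  a - b - (c - d) + (c - e - (g - b)) + (g - d - (a - e)) = 0.
Proof.
have sumE (p q r s : W) : p - q - (r - s) = (p + s) - (q + r).
  by rewrite opprB opprD addrACA.
rewrite !sumE (addrC b c) subrKA (addrC e g) subrKA (addrC d a).
exact: subrr.
Qed.

Section GlV.
Variables (F : fieldType) (V : vectType F).
Implicit Types x y z : 'End(V).

Definition lfun_lie x y : 'End(V) := (x \o y)%VF - (y \o x)%VF.

Fact lfun_lie_linearl y : linear (lfun_lie^~ y).
Proof.
move=> a x z; apply/lfunP => v.
rewrite /lfun_lie !(add_lfunE, opp_lfunE, comp_lfunE, scale_lfunE) linearP /=.
by rewrite scalerBr opprD addrACA.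
Qed.

Fact lfun_lie_linearr x : linear (lfun_lie x).
Proof.
move=> a y z; apply/lfunP => v.
rewrite /lfun_lie !(add_lfunE, opp_lfunE, comp_lfunE, scale_lfunE) linearP /=.
by rewrite scalerBr opprD addrACA.
Qed.

Fact lfun_liexx x : lfun_lie x x = 0.
Proof. exact: subrr. Qed.

Fact lfun_lie_jacobi x y z :
  lfun_lie x (lfun_lie y z) + lfun_lie y (lfun_lie z x)
    + lfun_lie z (lfun_lie x y) = 0.
Proof.
apply/lfunP => v; rewrite zero_lfunE.
rewrite /lfun_lie !(add_lfunE, opp_lfunE, comp_lfunE) !linearB /= -!opprD.
exact: jacobi_cancel.
Qed.

HB.instance Definition _ := Vector_isLie.Build F 'End(V)
  lfun_lie_linearl lfun_lie_linearr lfun_liexx lfun_lie_jacobi.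

End GlV.

Section GlM.
Variables (F : fieldType) (m : nat).
Implicit Types A B C : 'M[F]_m.

Definition mx_lie A B : 'M[F]_m := A *m B - B *m A.

Fact mx_lie_linearl B : linear (mx_lie^~ B).
Proof.
move=> a A C; rewrite /mx_lie mulmxDl mulmxDr -scalemxAl -scalemxAr.
by rewrite scalerBr opprD addrACA.
Qed.

Fact mx_lie_linearr A : linear (mx_lie A).
Proof.
move=> a B C; rewrite /mx_lie mulmxDl mulmxDr -scalemxAl -scalemxAr.
by rewrite scalerBr opprD addrACA.
Qed.

Fact mx_liexx A : mx_lie A A = 0.
Proof. exact: subrr. Qed.

Fact mx_lie_jacobi A B C :
  mx_lie A (mx_lie B C) + mx_lie B (mx_lie C A) + mx_lie C (mx_lie A B) = 0.
Proof.
rewrite /mx_lie !mulmxBr !mulmxBl !mulmxA.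
exact: jacobi_cancel.
Qed.

HB.instance Definition _ := Vector_isLie.Build F 'M[F]_m
  mx_lie_linearl mx_lie_linearr mx_liexx mx_lie_jacobi.

End GlM.

(* Lie subalgebras are represented as subspaces of an ambient Lie algebra. *)

Section LieSubalgebras.
Variables (F : fieldType) (gT : lieType F).
Implicit Types L I U W K : {vspace gT}.

Definition lie_subalg L : Prop :=
  forall x y, x \in L -> y \in L -> lie x y \in L.

Definition lie_ideal L I : Prop :=
  (I <= L)%VS /\ (forall x y, x \in L -> y \in I -> lie x y \in I).

(* the span of all brackets [u, w], u \in U, w \in W; compare prodv *)
Definition liev U W : {vspace gT} :=
  <<[seq lie u w | u <- vbasis U, w <- vbasis W]>>%VS.

Definition lie_derived n L : {vspace gT} := iter n (fun U => liev U U) L.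

Definition lie_solvable L : Prop := exists n, lie_derived n L = 0%VS.

Definition lie_central L I : Prop :=
  forall x y, x \in L -> y \in I -> lie x y = 0.

Definition lie_abelian L : Prop := lie_central L L.

Definition lie_reductive L : Prop :=
  forall I, lie_ideal L I -> lie_solvable I -> lie_central L I.

Lemma memv_lie U W u w : u \in U -> w \in W -> lie u w \in liev U W.
Proof.
move=> Uu Ww; rewrite (coord_vbasis Uu) (coord_vbasis Ww).
have lie_suml n (a : 'I_n -> F) (s : 'I_n -> gT) y :
    lie (\sum_i a i *: s i) y = \sum_i a i *: lie (s i) y.
  elim/big_rec2: _ => [|i u' v' _ <-]; last exact: lie_linearl.
  by have:= lie_linearl y (-1) 0 0; rewrite /= scaler0 addr0 scaleN1r addNr.
have lie_sumr n (a : 'I_n -> F) (s : 'I_n -> gT) x :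
    lie x (\sum_i a i *: s i) = \sum_i a i *: lie x (s i).
  elim/big_rec2: _ => [|i u' v' _ <-]; last exact: lie_linearr.
  by have:= lie_linearr x (-1) 0 0; rewrite /= scaler0 addr0 scaleN1r addNr.
rewrite lie_suml; apply: rpred_sum => i _; apply: rpredZ.
rewrite lie_sumr; apply: rpred_sum => j _; apply: rpredZ.
by apply/memv_span/allpairs_f; rewrite mem_nth ?size_tuple.
Qed.

Lemma liev_subP U W K :
  (forall u w, u \in U -> w \in W -> lie u w \in K) <-> (liev U W <= K)%VS.
Proof.
split=> [sK | /subvP sK u w Uu Ww]; last exact/sK/memv_lie.
by apply/span_subvP => _ /allpairsP[[u w] /= [/vbasis_mem ? /vbasis_mem ? ->]];
  apply: sK.
Qed.

End LieSubalgebras.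

Definition lie_isog (F : fieldType) (gT hT : lieType F)
    (L : {vspace gT}) (M : {vspace hT}) : Prop :=
  exists phi : 'Hom(gT, hT),
    [/\ {in L &, injective phi}, (phi @: L)%VS = M
      & {in L &, forall x y, phi (lie x y) = lie (phi x) (phi y)}].

Section Forms.
Variables (F : fieldType) (V : vectType F).
Implicit Types (f : {biscalar V}) (x : 'End(V)).

Definition adj_defect f (v w : V) x : F^o := f (x v) w + f v (x w).

Fact adj_defect_linear f v w : linear (adj_defect f v w).
Proof.
move=> a x y; rewrite /adj_defect !add_lfunE !scale_lfunE.
rewrite linearPl linearPr /= scalerDr addrACA //.
Qed.

HB.instance Definition _ f v w :=
  GRing.isLinear.Build F 'End(V) F^o _ (adj_defect f v w)
    (adj_defect_linear f v w).

(* The subspace of gl(V) cut out by the equations f(xv, w) + f(v, xw) = 0 for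
   v, w in a basis of V; mem_Lf gives the defining property. *)
Definition Lf f : {vspace 'End(V)} :=
  (\bigcap_(i < \dim {:V}) \bigcap_(j < \dim {:V})
     lker (linfun (adj_defect f (vbasis {:V})`_i (vbasis {:V})`_j)))%VS.

Lemma mem_Lf f x :
  x \in Lf f <-> forall v w : V, f (x v) w = - f v (x w).
Proof.
split=> [Lx v w | Lx]; last first.
  rewrite memvE; apply/subv_bigcapP => i _; apply/subv_bigcapP => j _.
  by rewrite -memvE memv_ker lfunE /= /adj_defect Lx addNr.
apply/eqP; rewrite -subr_eq0 opprK; apply/eqP.
have basis0 i j : adj_defect f (vbasis {:V})`_(i : 'I_(\dim {:V}))
    (vbasis {:V})`_(j : 'I_(\dim {:V})) x = 0.
  move: Lx; rewrite memvE => /subv_bigcapP/(_ i isT)/subv_bigcapP/(_ j isT).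
  by rewrite -memvE memv_ker lfunE /= => /eqP.
have basisl (i : 'I_(\dim {:V})) : adj_defect f (vbasis {:V})`_i w x = 0.
  rewrite (coord_vbasis (memvf w)) /adj_defect linear_sumr linear_sum.
  rewrite linear_sumr -big_split big1 // => j _ /=.
  by rewrite !linearZ /= -mulrDr [X in _ * X]basis0 mulr0.
rewrite (coord_vbasis (memvf v)) linear_sum !linear_sumlz -big_split.
rewrite big1 // => i _ /=.
by rewrite linearZ /= !linearZl_LR -mulrDr [X in _ * X]basisl mulr0.
Qed.

Lemma Lf_subalg f : lie_subalg (Lf f).
Proof.
move=> x y /mem_Lf Lx /mem_Lf Ly; apply/mem_Lf => v w.
rewrite /lie /= /lfun_lie !(add_lfunE, opp_lfunE, comp_lfunE).
by rewrite linearBl linearBr /= !Lx !Ly !Lx !opprK opprB.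
Qed.

Definition indecomposable f : Prop :=
  forall U W : {vspace V},
    (U + W)%VS = {:V}%VS -> (U :&: W)%VS = 0%VS ->
    (forall u w, u \in U -> w \in W -> f u w = 0 /\ f w u = 0) ->
    U = 0%VS \/ W = 0%VS.

Definition gram f n (b : n.-tuple V) : 'M[F]_n :=
  \matrix_(i, j) f (tnth b i) (tnth b j).

End Forms.

(* lower triangular: the 1s are on the subdiagonal *)
Definition jordan0 (F : fieldType) n : 'M[F]_n :=
  \matrix_(i, j) (i == j.+1 :> nat)%:R.

Definition has_jordan_gram (F : fieldType) (V : vectType F)
    (f : {biscalar V}) t (d : 'I_t -> nat) : Prop :=
  exists b : (\sum_i d i)%N.-tuple V,
    basis_of {:V} b /\ gram f b = \mxdiag_(i < t) jordan0 F (d i).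

(* V = V_even, with Gram matrix J_(2 r_1) (+) ... (+) J_(2 r_t) *)
Definition form_even (F : fieldType) (V : vectType F) (f : {biscalar V}) : Prop :=
  exists t (r : 'I_t -> nat),
    (forall i, 0 < r i)%N /\ has_jordan_gram f (fun i => 2 * r i)%N.

(* Main.v *)
Require Import Defs.
From HB Require Import structures.
From mathcomp Require Import all_boot all_order all_algebra.
From mathcomp Require Import zify.
From Stdlib Require Import FunctionalExtensionality.

Set Implicit Arguments.
Unset Strict Implicit.
Unset Printing Implicit Defensive.

Import GRing.Theory.
Local Open Scope ring_scope.

(** In the Gram matrix J_2r the basis vectors of even index pair only with
    those of odd index.  Let E and O be the spans of the even and of the odd
    basis vectors over all blocks.  Both are totally isotropic, f is a perfect
    pairing on O x E, and once O is identified with the dual of E through it,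
    the other half of the form is f(e, o) = o(N e) for a nilpotent map N of E
    with one Jordan block of size r_i for each summand J_(2 r_i).  Such a
    presentation of f is called [polarized] below.

    A nilpotent N forces every x in L(f) to stabilise E and O, because E is the
    union of a chain of subspaces defined from f alone: the left radical ker N,
    then ker N^2, and so on; likewise for O.  Then x acts on E by a matrix A
    and on O by minus its transpose, and the remaining condition says that A
    commutes with N.  So L(f) is the centralizer C(N) of N in gl(m)
    ([Lf_isog_centralizer]).  The same argument with the opposite sign applies
    to self-adjoint maps; orthogonal decompositions of V are self-adjoint
    idempotents, so f is indecomposable exactly when 0 and 1 are the only
    idempotents of C(N) ([indecomposable_idem]).  What remains concerns C(N)
    alone.

    - One block: C(N) is the algebra of polynomials in N, commutative of
      dimension m, and local, hence without nontrivial idempotents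
      ([single_block_centralizer]).
    - All blocks of size 1: N = 0 and C(N) is gl(m), with m > 1.  A noncentral
      ideal of gl(m) contains an elementary matrix E_ij with i != j, and an
      ideal containing E_ij has a derived ideal containing E_ij too, so it is
      not solvable ([gl_reductive]).  Both claims divide by 2 when m = 2 and
      use a third index otherwise.
    - At least two blocks, one of which has size at least 2: the projection
      onto a block is a nontrivial idempotent of C(N), so f is decomposable
      ([jordan_centralizer_idem]); and C(N) is not reductive
      ([jordan_centralizer_not_reductive]).  Indeed the A in C(N) that kill
      both the image and the kernel of N form an abelian ideal, and the map
      sending the cyclic vector of the long block to the vector killed by N in
      another block lies in this ideal without commuting with the projection
      onto the long block. *)

(** * Ideals and isomorphisms of Lie subalgebras *)

Section LieGeneralities.
Variables (F : fieldType) (gT : lieType F).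
Implicit Types (x y z : gT) (L I : {vspace gT}).

HB.instance Definition _ x :=
  GRing.isLinear.Build F gT gT _ (lie x) (lie_linearr x).

Lemma lieDl x y z : lie (x + y) z = lie x z + lie y z.
Proof. by have := lie_linearl z 1 x y; rewrite /= !scale1r. Qed.

Lemma lieC x y : lie x y = - lie y x.
Proof.
apply/eqP; rewrite -addr_eq0; apply/eqP.
by have := liexx (x + y); rewrite lieDl !linearD /= !liexx add0r addr0.
Qed.

Lemma lie_leibniz x y z : lie x (lie y z) = lie (lie x y) z + lie y (lie x z).
Proof.
have := lie_jacobi x y z.
rewrite (lieC z (lie x y)) (lieC z x) linearN /= => /eqP.
by rewrite subr_eq0 subr_eq => /eqP ->.
Qed.

Definition lie_centralizer x : {vspace gT} := lker (linfun (lie x)).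

Lemma mem_centralizer x y : (y \in lie_centralizer x) = (lie x y == 0).
Proof. by rewrite memv_ker lfunE. Qed.

Lemma liev_mono (U U' W W' : {vspace gT}) :
  (U <= U')%VS -> (W <= W')%VS -> (liev U W <= liev U' W')%VS.
Proof.
move=> /subvP sU /subvP sW; apply/liev_subP => u w Uu Ww.
by apply: memv_lie; [apply: sU | apply: sW].
Qed.

(** The Jacobi identity makes every [lie x] a derivation. *)
Lemma ideal_derived1 L I : lie_ideal L I -> lie_ideal L (liev I I).
Proof.
move=> [sIL idI]; split.
  apply: subv_trans (sIL); apply/liev_subP => y z Iy Iz.
  by apply: idI => //; apply: (subvP sIL).
move=> x y Lx; suff /subvP sub: (liev I I <= linfun (lie x) @^-1: liev I I)%VS.
  by move/sub; rewrite -memv_preim lfunE.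
apply/liev_subP => u w Iu Iw; rewrite -memv_preim lfunE /= lie_leibniz.
by apply: memvD; apply: memv_lie => //; apply: idI.
Qed.

Lemma ideal_derived L I n : lie_ideal L I -> lie_ideal L (lie_derived n I).
Proof. by move=> idI; elim: n => //= n; apply: ideal_derived1. Qed.

Lemma ideal_self L I : lie_ideal L I -> lie_ideal I I.
Proof. by move=> [/subvP sIL idI]; split=> // x y /sIL; apply: idI. Qed.

Lemma abelian_reductive L : lie_abelian L -> lie_reductive L.
Proof. by move=> abL I [/subvP sIL _] _ x y Lx /sIL Ly; apply: abL. Qed.

End LieGeneralities.

Section Isomorphism.
Variables (F : fieldType) (gT hT : lieType F).
Variables (L : {vspace gT}) (M : {vspace hT}).

(** The inverse is only needed on [M], but must be linear on the whole ambient
    space: composing with the projection onto [L] makes a pseudo-inverse of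
    [phi] land in [L]. *)
Lemma lie_isog_sym : lie_subalg L -> lie_isog L M -> lie_isog M L.
Proof.
move=> subL [phi [phiI phiLM phi_lie]].
pose phiL := (phi \o projv L)%VF.
pose psi := (projv L \o phiL^-1)%VF.
have psiL y : psi y \in L by rewrite comp_lfunE memv_proj.
have psiK y : y \in M -> phi (psi y) = y.
  rewrite -phiLM => /memv_imgP[x Lx yE].
  have: phiL (phiL^-1 y)%VF = y.
    apply: limg_lfunVK; apply/memv_imgP; exists x; first exact: memvf.
    by rewrite comp_lfunE projv_id.
  by rewrite !comp_lfunE.
have phiM x : x \in L -> phi x \in M by rewrite -phiLM; apply: memv_img.
exists psi; split.
- by move=> y z My Mz /(congr1 phi); rewrite !psiK.
- apply/vspaceP => x; apply/memv_imgP/idP => [[y _ ->] // | Lx].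
  by exists (phi x); [apply: phiM | apply: phiI; rewrite // psiK ?phiM].
- move=> y z My Mz; have lyz : phi (lie (psi y) (psi z)) = lie y z.
    by rewrite phi_lie // !psiK.
  have Lyz := subL _ _ (psiL y) (psiL z).
  by apply: phiI => //; rewrite psiK -lyz // phiM.
Qed.

(** The image of a solvable ideal of [L] is a solvable ideal of [M], and being
    central is reflected because [phi] is injective on [L]. *)
Lemma lie_isog_reductive : lie_isog L M -> lie_reductive M -> lie_reductive L.
Proof.
move=> [phi [phiI phiLM phi_lie]] redM I idI solI x y Lx Iy.
have [sIL idIL] := idI; have /subvP IL := sIL.
have phiM z : z \in L -> phi z \in M by rewrite -phiLM; apply: memv_img.
apply: phiI; rewrite ?mem0v ?(IL (lie x y)) ?idIL // linear0 phi_lie ?(IL y) //.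
apply: (redM (phi @: I)%VS); [| | exact: phiM | exact: memv_img].
  split; first by rewrite -phiLM limgS.
  rewrite -{1}phiLM => _ _ /memv_imgP[u Lu ->] /memv_imgP[w Iw ->].
  by rewrite -phi_lie ?(IL w) //; apply: memv_img; apply: idIL.
case: solI => k solk; exists k; apply/eqP; rewrite -subv0 -(limg0 phi) -solk.
elim: k {solk} => //= k IHk.
have /subvP DI : (lie_derived k I <= I)%VS.
  by case: (ideal_derived k (ideal_self idI)).
apply: subv_trans (liev_mono IHk IHk) _.
apply/liev_subP => _ _ /memv_imgP[u Du ->] /memv_imgP[w Dw ->].
by rewrite -phi_lie ?IL ?DI //; apply: memv_img; apply: memv_lie.
Qed.

Lemma lie_isog_abelian :
  lie_subalg L -> lie_isog L M -> lie_abelian M -> lie_abelian L.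
Proof.
move=> subL [phi [phiI phiLM phi_lie]] abM x y Lx Ly.
apply: phiI; rewrite ?mem0v ?subL // linear0 phi_lie //.
by apply: abM; rewrite -phiLM; apply: memv_img.
Qed.

Lemma lie_isog_dim : lie_isog L M -> \dim L = \dim M.
Proof.
move=> [phi [phiI <- _]]; apply/esym/limg_dim_eq/eqP; rewrite -subv0.
apply/subvP => x /memv_capP[Lx]; rewrite memv_ker => /eqP px0.
by rewrite memv0; apply/eqP/phiI; rewrite ?mem0v ?linear0.
Qed.

End Isomorphism.

(** * The general linear Lie algebra is reductive *)

Section GlReductive.
Variables (F : fieldType) (m : nat).
Implicit Types (A B : 'M[F]_m) (i j k : 'I_m) (I : {vspace 'M[F]_m}).
Local Notation E i j := (delta_mx i j : 'M[F]_m).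

Lemma lie_mxE A B : lie A B = A *m B - B *m A. Proof. by []. Qed.

Lemma mul_delta_mx_sandwich A i j k l : E i j *m A *m E k l = A j k *: E i l.
Proof.
transitivity (delta_mx i (0 : 'I_1) *m (delta_mx (0 : 'I_1) j *m
    (A *m delta_mx k (0 : 'I_1))) *m delta_mx (0 : 'I_1) l).
  by rewrite -(mul_delta_mx (0 : 'I_1) i j) -(mul_delta_mx (0 : 'I_1) k l) !mulmxA.
have -> : delta_mx (0 : 'I_1) j *m (A *m delta_mx k (0 : 'I_1)) = (A j k)%:M.
  rewrite -rowE -colE.
  by apply/matrixP => p q; rewrite !ord1 !mxE eqxx mulr1n.
by rewrite mul_mx_scalar -scalemxAl mul_delta_mx.
Qed.

Lemma lie_delta_mx i j k l :
  lie (E i j) (E k l) = E i l *+ (j == k) - E k j *+ (l == i).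
Proof. by rewrite lie_mxE !mul_delta_mx_cond. Qed.

Lemma ex_third i j : (2 < m)%N -> exists k, k != i /\ k != j.
Proof.
move=> m_gt2; have: (0 < #|~: [set i; j]|)%N.
  rewrite cardsCs setCK card_ord subn_gt0 (leq_ltn_trans _ m_gt2) // cards2.
  by case: (_ != _).
by case/card_gt0P => k; rewrite !inE negb_or => /andP[]; exists k.
Qed.

Hypothesis m_ok : (2 < m)%N \/ (2%:R != 0 :> F).

(** With a third index k, E_ij = [E_ik, E_kj] and both factors lie in [I];
    otherwise [E_ii - E_jj, E_ij] = 2 E_ij and E_ii - E_jj = [E_ij, E_ji]. *)
Lemma gl_ideal_perfect I i j :
  lie_ideal fullv I -> i != j -> E i j \in I -> E i j \in liev I I.
Proof.
move=> [_ idI] ij Iij; have lI x y : y \in I -> lie x y \in I.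
  by apply: idI; apply: memvf.
have ji := ij; rewrite eq_sym in ji.
case: m_ok => [m_gt2 | two_neq0].
  have [k [ki kj]] := ex_third i j m_gt2.
  have Eik : E i k = lie (- E j k) (E i j).
    rewrite lieC linearN opprK /= lie_delta_mx eqxx (negPf ki).
    by rewrite mulr0n subr0.
  have Ekj : E k j = lie (E k i) (E i j).
    by rewrite lie_delta_mx eqxx [j == k]eq_sym (negPf kj) mulr0n subr0.
  have -> : E i j = lie (E i k) (E k j).
    by rewrite lie_delta_mx eqxx (negPf ji) mulr0n subr0.
  rewrite {1}Eik Ekj.
  by apply: memv_lie; apply: lI.
pose h := E i i - E j j.
have hE : h = lie (- E j i) (E i j).
  by rewrite lieC linearN opprK /= lie_delta_mx !eqxx.
have -> : E i j = 2^-1 *: lie h (E i j).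
  rewrite lie_mxE mulmxBl mulmxBr !mul_delta_mx_cond !eqxx (negPf ji).
  rewrite !mulr0n subr0 sub0r opprK -mulr2n -scaler_nat scalerA mulVf //.
  by rewrite scale1r.
rewrite hE.
by rewrite memvZ // memv_lie // lI.
Qed.

(** For i != j, bracketing A with E_ii and then E_jj isolates the two entries
    T = A_ij E_ij + A_ji E_ji.  A further bracket with E_jk, for a third index
    k, leaves A_ij E_ik; without one, [E_ii, T] + T = 2 A_ij E_ij.  Hence A is
    diagonal, and then [A, E_ij] = (A_ii - A_jj) E_ij. *)
Lemma gl_ideal_scalar I A :
  lie_ideal fullv I -> (forall i j, i != j -> E i j \notin I) ->
  A \in I -> is_scalar_mx A.
Proof.
move=> [_ idI] noE IA; have lI x y : y \in I -> lie x y \in I.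
  by apply: idI; apply: memvf.
have rI x y : x \in I -> lie x y \in I by move=> Ix; rewrite lieC memvN lI.
have coefE B c i j : i != j -> B \in I -> B = c *: E i j -> c = 0.
  move=> ij IB Bc; apply: contraNeq (noE i j ij) => c0.
  by rewrite -(scalerK c0 (E i j)) -Bc memvZ.
have A_offdiag i j : i != j -> A i j = 0.
  move=> ij; pose T := lie (lie (E i i) A) (E j j).
  have ji := ij; rewrite eq_sym in ji.
  have TE : T = A i j *: E i j + A j i *: E j i.
    rewrite /T !lie_mxE mulmxBl mulmxBr mul_delta_mx_sandwich !mulmxA.
    rewrite mul_delta_mx_sandwich -[A *m _ *m _]mulmxA !mul_delta_mx_0 //.
    by rewrite mulmx0 mul0mx subr0 sub0r opprK.
  have IT : T \in I by rewrite rI // lI.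
  case: m_ok => [m_gt2 | two_neq0].
    have [k [ki kj]] := ex_third i j m_gt2.
    apply: (coefE (lie T (E j k)) _ i k); [by rewrite eq_sym | exact: rI |].
    rewrite TE.
    rewrite lie_mxE mulmxDl mulmxDr -!scalemxAl -!scalemxAr !mul_delta_mx_cond.
    by rewrite eqxx (negPf ki) (negPf kj) (negPf ij) !mulr0n !scaler0 !addr0 subr0.
  have : A i j + A i j = 0.
    apply: (coefE (lie (E i i) T + T) _ i j) => //.
      by apply: memvD => //; apply: lI.
    rewrite TE lie_mxE mulmxDl mulmxDr -!scalemxAl -!scalemxAr !mul_delta_mx_cond.
    rewrite !eqxx (negPf ij) (negPf ji) !mulr0n !scaler0 addr0 add0r addrACA addNr.
    by rewrite addr0 -scalerDl.
  by move/eqP; rewrite -mulr2n -mulr_natl mulf_eq0 (negPf two_neq0) => /eqP.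
have A_diag i j : i != j -> A i i = A j j.
  move=> ij; apply/eqP; rewrite -subr_eq0; apply/eqP.
  apply: (coefE (lie A (E i j)) _ i j) => //; first exact: rI.
  rewrite lie_mxE scalerBl.
  apply/matrixP => p q; rewrite !mxE (bigD1 i) //= [X in _ - X](bigD1 j) //=.
  rewrite !big1 ?addr0 => [|k kj|k ki];
    rewrite !mxE ?(negPf kj) ?(negPf ki) ?andbF ?mul0r ?mulr0 //.
  rewrite !eqxx !andbT.
  case: (eqVneq p i) => [->|pi]; case: (eqVneq q j) => [->|qj];
    rewrite ?eqxx /= ?mulr0 ?mul0r ?mulr1 ?mul1r ?subrr //.
    by rewrite (A_offdiag j q) ?subrr // eq_sym.
  by rewrite (A_offdiag p i) ?subrr.
case: (pickP (fun _ : 'I_m => true)) => [i0 _ | m0]; last first.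
  by apply/is_scalar_mxP; exists 0; apply/matrixP => i j; have := m0 i.
apply/is_scalar_mxP; exists (A i0 i0); apply/matrixP => i j; rewrite !mxE.
case: (eqVneq i j) => [-> | ij]; last by rewrite (A_offdiag _ _ ij).
by rewrite /= mulr1n; case: (eqVneq j i0) => [-> | /A_diag].
Qed.

(** A solvable ideal contains no E_ij off the diagonal, since these survive in
    all its derived ideals; so it consists of scalar matrices. *)
Lemma gl_reductive : lie_reductive {: 'M[F]_m}%VS.
Proof.
move=> I idI [k solI] B A _ IA.
suff /is_scalar_mxP[a ->] : is_scalar_mx A by rewrite lie_mxE scalar_mxC subrr.
apply: gl_ideal_scalar IA => // i j ij; apply/negP => Iij.
have: E i j \in lie_derived k I.
  elim: k {solI} => //= k; apply: gl_ideal_perfect => //.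
  exact: ideal_derived.
rewrite solI memv0 => /eqP/matrixP/(_ i j)/eqP.
by rewrite !mxE !eqxx oner_eq0.
Qed.

End GlReductive.

(** * Forms with a perfect pairing between two isotropic halves *)

(** The last field makes [e] and [o] together a basis of V: the coordinates of
    v along [e] are read off by pairing with [o] on the left, and those along
    [o] by pairing with [e] on the right.  The matrix [N] acts on columns of
    coordinates along [e]. *)
Record polarized (F : fieldType) (V : vectType F) (f : {biscalar V})
    n (N : 'M[F]_n) (e o : 'I_n -> V) : Prop := Polarized {
  pol_ee : forall i j, f (e i) (e j) = 0;
  pol_oo : forall i j, f (o i) (o j) = 0;
  pol_oe : forall i j, f (o i) (e j) = (i == j)%:R;
  pol_eo : forall i j, f (e i) (o j) = N j i;
  pol_sum : forall v, v = \sum_i f (o i) v *: e i + \sum_i f v (e i) *: o i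
}.

Section Polarization.
Variables (F : fieldType) (V : vectType F) (f : {biscalar V}).
Variables (n : nat) (N : 'M[F]_n) (e o : 'I_n -> V).
Hypothesis fP : polarized f N e o.
Implicit Types (u v w : V) (a b : 'cV[F]_n) (A : 'M[F]_n) (c : F).

Definition ecoef v : 'cV[F]_n := \col_i f (o i) v.
Definition ocoef v : 'cV[F]_n := \col_i f v (e i).
Definition recombine a b : V := \sum_i a i 0 *: e i + \sum_i b i 0 *: o i.

Lemma recombineK v : recombine (ecoef v) (ocoef v) = v.
Proof.
rewrite {3}(pol_sum fP v) /recombine.
by congr (_ + _); apply: eq_bigr => i _; rewrite mxE.
Qed.

Lemma ecoefK a b : ecoef (recombine a b) = a.
Proof.
apply/colP => i; rewrite mxE /recombine linearD !linear_sum /=.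
rewrite (bigD1 i) //= linearZ /= (pol_oe fP) eqxx mulr1 !big1 ?addr0 // => j.
  by rewrite linearZ /= (pol_oo fP) mulr0.
by rewrite linearZ /= (pol_oe fP) eq_sym => /negPf->; rewrite mulr0.
Qed.

Lemma ocoefK a b : ocoef (recombine a b) = b.
Proof.
apply/colP => i; rewrite mxE /recombine linearDl !linear_sumlz /=.
rewrite [X in _ + X](bigD1 i) //= linearZl_LR /= (pol_oe fP) eqxx mulr1.
rewrite !big1 ?addr0 ?add0r // => j.
  by rewrite linearZl_LR /= (pol_oe fP) => /negPf->; rewrite mulr0.
by rewrite linearZl_LR /= (pol_ee fP) mulr0.
Qed.

Lemma coef_inj u v : ecoef u = ecoef v -> ocoef u = ocoef v -> u = v.
Proof. by move=> ea eb; rewrite -[u]recombineK -[v]recombineK ea eb. Qed.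

Lemma ecoef_linear : linear ecoef.
Proof. by move=> c u v; apply/colP => i; rewrite !mxE linearP. Qed.

Lemma ocoef_linear : linear ocoef.
Proof. by move=> c u v; apply/colP => i; rewrite !mxE linearPl. Qed.

HB.instance Definition _ :=
  GRing.isLinear.Build F V 'cV[F]_n _ ecoef ecoef_linear.
HB.instance Definition _ :=
  GRing.isLinear.Build F V 'cV[F]_n _ ocoef ocoef_linear.

Lemma ecoef_e i : ecoef (e i) = delta_mx i 0.
Proof. by apply/colP => j; rewrite !mxE (pol_oe fP) andbT. Qed.

Lemma ocoef_e i : ocoef (e i) = 0.
Proof. by apply/colP => j; rewrite !mxE (pol_ee fP). Qed.

Lemma ecoef_o i : ecoef (o i) = 0.
Proof. by apply/colP => j; rewrite !mxE (pol_oo fP). Qed.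

Lemma ocoef_o i : ocoef (o i) = delta_mx i 0.
Proof. by apply/colP => j; rewrite !mxE (pol_oe fP) eq_sym andbT. Qed.

(** All computations with f reduce to matrix algebra through this formula. *)
Lemma polarizedE v w :
  f v w = ((ocoef v)^T *m ecoef w + (ocoef w)^T *m N *m ecoef v) 0 0.
Proof.
have fe i : f (e i) w = ((ocoef w)^T *m N) 0 i.
  rewrite {1}(pol_sum fP w) linearD !linear_sum /= big1 => [|j _]; last first.
    by rewrite linearZ /= (pol_ee fP) mulr0.
  by rewrite add0r mxE; apply: eq_bigr => j _; rewrite linearZ /= (pol_eo fP) !mxE.
rewrite {1}(pol_sum fP v) linearDl !linear_sumlz /= addrC !mxE.
by congr (_ + _); apply: eq_bigr => i _;
  rewrite linearZl_LR /= ?fe !mxE // mulrC.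
Qed.

(** The action of a matrix on the even half, extended to the odd half by its
    dual action up to the sign [c]. *)
Definition gl_polar c A v : V := recombine (A *m ecoef v) (c *: (A^T *m ocoef v)).

Lemma gl_polar_linear c A : linear (gl_polar c A).
Proof.
move=> d u v; rewrite /gl_polar !linearP /=.
rewrite /recombine scalerDr addrACA !scaler_sumr -!big_split.
by apply: eq_bigr => i _; rewrite !mxE !scalerDl !scalerA.
Qed.

HB.instance Definition _ c A :=
  GRing.isLinear.Build F V V _ (gl_polar c A) (gl_polar_linear c A).

(** [c = -1] gives the elements of L(f), and [c = 1] the self-adjoint maps,
    whose idempotents are the orthogonal decompositions of V. *)
Definition adjoint_with c (x : 'End(V)) : Prop :=
  forall v w, f (x v) w = c * f v (x w).

Lemma gl_polar_adjoint c A : c * c = 1 -> A *m N = N *m A ->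
  adjoint_with c (linfun (gl_polar c A)).
Proof.
move=> cc AN v w; rewrite !lfunE /= !polarizedE !(ecoefK, ocoefK).
rewrite !linearZ /= !trmx_mul !trmxK -!scalemxAl -!mulmxA.
rewrite [N *m (A *m _)]mulmxA -AN -!mulmxA mxE [in RHS]mxE mulrDr !mxE mulrA cc mul1r.
by [].
Qed.

Definition polar_mx (x : 'End(V)) : 'M[F]_n := \matrix_(i, j) f (o i) (x (e j)).

Lemma polar_mx_linear : linear polar_mx.
Proof.
move=> c x y; apply/matrixP => i j.
by rewrite !mxE add_lfunE scale_lfunE linearP.
Qed.

HB.instance Definition _ :=
  GRing.isLinear.Build F 'End(V) 'M[F]_n _ polar_mx polar_mx_linear.

Lemma polar_mxK c A : polar_mx (linfun (gl_polar c A)) = A.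
Proof.
apply/matrixP => i j; rewrite mxE lfunE /= -[LHS]/((f (o i)) _).
have /colP/(_ i) := ecoefK (A *m ecoef (e j)) (c *: (A^T *m ocoef (e j))).
by rewrite mxE => ->; rewrite ecoef_e -colE mxE.
Qed.

Section Adjoint.
Variables (c : F) (x : 'End(V)) (k : nat).
Hypotheses (cc : c * c = 1) (x_adj : adjoint_with c x) (N_nil : N ^+ k = 0).

(** For v in E, the vector u of E with coordinates N v satisfies
    f(v, w) = f(w, u) for all w.  Moving x across twice, f(x v, e_i) equals
    f(e_i, x u) up to a scalar, and this vanishes as soon as x u is in E, because
    E is isotropic.  So the claim for u implies the claim for v, and iterating
    N leads to u = 0. *)
Lemma adjoint_stable_e v : ocoef v = 0 -> ocoef (x v) = 0.
Proof.
have: N ^+ k *m ecoef v = 0 by rewrite N_nil mul0mx.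
elim: k v => [|l IHl] v; first by rewrite mul1mx => av bv;
  rewrite (coef_inj (u := v) (v := 0)) ?linear0.
rewrite exprSr -mulmxE -mulmxA => Nv bv; pose u := recombine (N *m ecoef v) 0.
have xu : ocoef (x u) = 0 by apply: IHl; rewrite ?ecoefK ?ocoefK.
have fuv w : f v w = f w u.
  by rewrite !polarizedE ecoefK ocoefK bv !trmx0 !mul0mx add0r addr0 mulmxA.
apply/colP => i; rewrite !mxE x_adj fuv x_adj.
by rewrite polarizedE xu ocoef_e !trmx0 !mul0mx addr0 mxE !mulr0.
Qed.

(** The mirror image of [adjoint_stable_e], with the transpose of N acting on
    the dual half. *)
Lemma adjoint_stable_o v : ecoef v = 0 -> ecoef (x v) = 0.
Proof.
have x_adj' u w : f u (x w) = c * f (x u) w by rewrite x_adj mulrA cc mul1r.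
have: (ocoef v)^T *m N ^+ k = 0 by rewrite N_nil mulmx0.
elim: k v => [|l IHl] v; first by rewrite mulmx1 => bv av;
  rewrite (coef_inj (u := v) (v := 0)) ?linear0 // -[LHS]trmxK bv trmx0.
rewrite exprS -mulmxE mulmxA => Nv av; pose u := recombine 0 (N^T *m ocoef v).
have xu : ecoef (x u) = 0.
  by apply: IHl; rewrite ?ecoefK ?ocoefK // trmx_mul trmxK.
have fuv w : f w v = f u w.
  rewrite !polarizedE ecoefK ocoefK av !mulmx0 add0r addr0.
  by rewrite trmx_mul trmxK.
apply/colP => i; rewrite !mxE x_adj' fuv x_adj'.
by rewrite polarizedE xu ecoef_o !mulmx0 addr0 mxE !mulr0.
Qed.

Lemma adjoint_ecoef v : ecoef (x v) = polar_mx x *m ecoef v.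
Proof.
rewrite {1}(pol_sum fP v) linearD linearD /= [X in _ + X]adjoint_stable_o.
  rewrite addr0 !linear_sum /=; apply/colP => i; rewrite summxE mxE.
  by apply: eq_bigr => j _; rewrite !linearZ /= !mxE mulrC.
by rewrite linear_sum big1 // => i _; rewrite linearZ /= ecoef_o scaler0.
Qed.

Lemma adjoint_polar_mxM (y : 'End(V)) :
  polar_mx (x \o y)%VF = polar_mx x *m polar_mx y.
Proof.
apply/matrixP => i j; have /colP/(_ i) := adjoint_ecoef (y (e j)).
rewrite mxE => xyE; rewrite mxE comp_lfunE xyE !mxE.
by apply: eq_bigr => l _; rewrite !mxE.
Qed.

Lemma adjoint_ocoef v : ocoef (x v) = c *: ((polar_mx x)^T *m ocoef v).
Proof.
rewrite {1}(pol_sum fP v) addrC linearD linearD /= [X in _ + X]adjoint_stable_e.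
  rewrite addr0 !linear_sum /=; apply/colP => i; rewrite summxE !mxE mulr_sumr.
  apply: eq_bigr => j _; rewrite !linearZ /= !mxE x_adj mulrCA.
  by congr (_ * _); rewrite mulrC.
by rewrite linear_sum big1 // => i _; rewrite linearZ /= ocoef_e scaler0.
Qed.

Lemma adjoint_polar : x = linfun (gl_polar c (polar_mx x)).
Proof.
apply/lfunP => v; rewrite lfunE /=; apply: coef_inj.
  by rewrite ecoefK adjoint_ecoef.
by rewrite ocoefK adjoint_ocoef.
Qed.

(** This is the adjunction read on the pairs (e_j, o_i), where f is given
    by N. *)
Lemma adjoint_comm : polar_mx x *m N = N *m polar_mx x.
Proof.
apply/matrixP => i j; have := x_adj (e j) (o i).
rewrite !polarizedE ocoef_e adjoint_stable_e ?ocoef_e // !trmx0 !mul0mx !add0r.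
rewrite adjoint_ecoef adjoint_ocoef ecoef_e ocoef_o.
rewrite trmx_delta [(c *: _)^T]linearZ /= trmx_mul trmxK trmx_delta.
rewrite -!scalemxAl [in RHS]mxE mulrA cc mul1r -!mulmxA -!rowE.
by rewrite !mulmxA -[_ *m delta_mx j 0]colE -colE !mxE => ->.
Qed.

End Adjoint.
End Polarization.

(** * Reduction to the centralizer of a nilpotent matrix *)

Section Reduction.
Variables (F : fieldType) (V : vectType F) (f : {biscalar V}).
Variables (n : nat) (N : 'M[F]_n) (e o : 'I_n -> V) (k : nat).
Hypotheses (fP : polarized f N e o) (N_nil : N ^+ k = 0).
Implicit Types (A : 'M[F]_n).

Lemma mem_Lf_adjoint x : x \in Lf f <-> adjoint_with f (-1) x.
Proof.
by split=> [/mem_Lf adj | adj]; [| apply/mem_Lf] => v w; rewrite adj mulN1r.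
Qed.

Lemma mem_centralizer_mx A : (A \in lie_centralizer N) = (A *m N == N *m A).
Proof. by rewrite mem_centralizer lie_mxE subr_eq0 eq_sym. Qed.

(** Restriction to the even half is the isomorphism: on the odd half an element
    of L(f) acts by minus the transpose. *)
Lemma Lf_isog_centralizer : lie_isog (Lf f) (lie_centralizer N).
Proof.
have N1 : (-1) * (-1) = 1 :> F by rewrite mulrNN mulr1.
have toN x : x \in Lf f -> adjoint_with f (-1) x by move/mem_Lf_adjoint.
exists (linfun (polar_mx f e o)); split.
- move=> x y /toN Lx /toN Ly; rewrite !lfunE /= => xy.
  by rewrite (adjoint_polar fP N1 Lx N_nil) xy -(adjoint_polar fP N1 Ly N_nil).
- apply/vspaceP => A; rewrite mem_centralizer_mx; apply/memv_imgP/eqP.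
    by case=> x /toN Lx ->; rewrite lfunE; apply: (adjoint_comm fP N1 Lx N_nil).
  move=> AN; exists (linfun (gl_polar f e o (-1) A)).
    by apply/mem_Lf_adjoint/(gl_polar_adjoint fP).
  by rewrite lfunE /= (polar_mxK fP).
move=> x y /toN Lx /toN Ly; rewrite !lfunE /=.
rewrite {1}/lie /= /lfun_lie linearB /=.
by rewrite (adjoint_polar_mxM fP N1 Lx N_nil) (adjoint_polar_mxM fP N1 Ly N_nil).
Qed.

(** Orthogonal decompositions V = U + W correspond to self-adjoint idempotents,
    with image U and kernel W, hence to idempotents of C(N). *)
Lemma indecomposable_idem : indecomposable f <->
  (forall A, A *m A = A -> A *m N = N *m A -> A = 0 \/ A = 1%:M).
Proof.
have one1 : 1 * 1 = 1 :> F by rewrite mulr1.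
split=> [indf A AA AN | idem U W UW_full UW0 fUW].
  pose x := linfun (gl_polar f e o 1 A).
  have xE v : x v = gl_polar f e o 1 A v by rewrite lfunE.
  have xA := gl_polar_adjoint fP one1 AN; rewrite -/x in xA.
  have xx v : x (x v) = x v.
    apply: (coef_inj fP); rewrite !xE !(ecoefK fP, ocoefK fP) ?scale1r.
      by rewrite mulmxA AA.
    by rewrite mulmxA -trmx_mul AA.
  case: (indf (limg x) (lker x)).
  - apply/vspaceP => v; rewrite memvf -[v](subrK (x v)) addrC memv_add //.
      exact/memv_img/memvf.
    by rewrite memv_ker linearB /= xx subrr.
  - apply/eqP; rewrite -subv0; apply/subvP => v /memv_capP[/memv_imgP[u _ ->]].
    by rewrite memv_ker xx memv0.
  - move=> _ w /memv_imgP[u _ ->]; rewrite memv_ker => /eqP xw0; split.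
      by rewrite xA xw0 linear0 mulr0.
    have := xA w u; rewrite xw0 mul1r => <-.
    by rewrite linear0l.
  - move=> x0; left; rewrite -(polar_mxK fP 1 A) -/x.
    suff -> : x = 0 by rewrite linear0.
    apply/lfunP => v; rewrite zero_lfunE; apply/eqP.
    by rewrite -memv0 -x0 memv_img ?memvf.
  - move=> x1; right; rewrite -(polar_mxK fP 1 A) -/x.
    have xid v : x v = v.
      by apply/eqP; rewrite -subr_eq0 -memv0 -x1 memv_ker linearB /= xx subrr.
    by apply/matrixP => i j; rewrite !mxE xid (pol_oe fP).
pose x := daddv_pi U W.
have xA : adjoint_with f 1 x.
  move=> v w; rewrite mul1r.
  have dec t : t = x t + daddv_pi W U t.
    by rewrite daddv_pi_add ?UW_full ?memvf.
  rewrite {2}(dec v) {1}(dec w) linearD linearDl /=.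
  have [-> _] : f (x v) (daddv_pi W U w) = 0 /\ f (daddv_pi W U w) (x v) = 0.
    by apply: fUW; apply: memv_pi.
  have [_ ->] : f (x w) (daddv_pi W U v) = 0 /\ f (daddv_pi W U v) (x w) = 0.
    by apply: fUW; apply: memv_pi.
  by [].
have xx : (x \o x)%VF = x by apply/lfunP => v; rewrite comp_lfunE daddv_pi_id ?memv_pi.
pose A := polar_mx f e o x.
have AA : A *m A = A.
  by rewrite -(adjoint_polar_mxM fP one1 xA N_nil) xx.
have := adjoint_polar fP one1 xA N_nil; rewrite -/A.
case: (idem A AA (adjoint_comm fP one1 xA N_nil)) => ->.
  move=> x0; left; apply/eqP; rewrite -subv0; apply/subvP => v Uv.
  rewrite -(daddv_pi_id UW0 Uv) -/x x0 lfunE /=.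
  rewrite (coef_inj fP (u := gl_polar f e o 1 0 v) (v := 0)) ?mem0v //;
    rewrite ?(ecoefK fP) ?(ocoefK fP) !linear0 ?trmx0 ?mul0mx ?scaler0 //.
move=> x1; right; apply/eqP; rewrite -subv0; apply/subvP => v Wv.
have : x v = 0.
  have := daddv_pi_add UW0 (w := v); rewrite UW_full memvf => /(_ isT).
  have WU0 : (W :&: U)%VS = 0%VS by rewrite capvC.
  by rewrite (daddv_pi_id WU0 Wv) -[X in _ = X]add0r => /addIr.
rewrite x1 lfunE /= => v0; rewrite memv0; apply/eqP.
rewrite -v0; apply: (coef_inj fP); rewrite ?(ecoefK fP) ?(ocoefK fP).
  by rewrite mul1mx.
by rewrite trmx1 mul1mx scale1r.
Qed.

End Reduction.

(** * Forms of type J_2r as polarized forms *)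

Section JordanSum.
Variables (F : fieldType) (t : nat) (d : 'I_t -> nat).
Implicit Types s : 'I_(\sum_i d i)%N.

Definition jordan_sum : 'M[F]_(\sum_i d i) := \mxdiag_(i < t) jordan0 F (d i).

Lemma jordan_sumE s s' : jordan_sum s s' =
  ((tagnat.sig1 s == tagnat.sig1 s') &&
     (tagnat.sig2 s == (tagnat.sig2 s').+1 :> nat))%:R.
Proof.
rewrite mxE; move: (tagnat.sig2 s) (tagnat.sig2 s').
move: (tagnat.sig1 s) (tagnat.sig1 s') => i j x y.
case: eqP => [ij | _]; last by rewrite mxE.
by case: _ / ij in y *; rewrite conform_mx_id mxE.
Qed.

Lemma tr_jordan_sumE s s' : jordan_sum^T s s' =
  ((tagnat.sig1 s' == tagnat.sig1 s) &&
     (tagnat.sig2 s' == (tagnat.sig2 s).+1 :> nat))%:R.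
Proof. by rewrite mxE jordan_sumE. Qed.

(** The entry (s, s') of the k-th power vanishes unless s' is k steps after s in
    the same block. *)
Lemma jordan_sum_nilpotent : jordan_sum^T ^+ (\sum_i d i)%N = 0.
Proof.
have Nk k s s' : tagnat.sig2 s' != (tagnat.sig2 s + k)%N :> nat ->
    (jordan_sum^T ^+ k) s s' = 0.
  elim: k s => [|k IHk] s hs.
    by rewrite mxE; case: (s =P s') hs => // ->; rewrite addn0 eqxx.
  rewrite exprS -mulmxE mxE big1 // => u _; rewrite tr_jordan_sumE.
  case: eqP => [_|]; last by rewrite mul0r.
  case: eqP => [hu|]; last by rewrite mul0r.
  by rewrite IHk ?mulr0 // hu addSnnS.
apply/matrixP => s s'; rewrite Nk ?mxE // neq_ltn; apply/orP; left.
apply: leq_trans (ltn_ord (tagnat.sig2 s')) _.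
by rewrite (leq_trans _ (leq_addl _ _)) // (bigD1 (tagnat.sig1 s')) //= leq_addr.
Qed.

End JordanSum.

Section JordanPolarization.
Variables (F : fieldType) (V : vectType F) (f : {biscalar V}).
Variables (t : nat) (r : 'I_t -> nat).

(** In each block, e_k and o_k are the basis vectors of index 2k and 2k + 1.
    The subdiagonal ones of J_2r then read f(o_k, e_k) = 1 and
    f(e_(k+1), o_k) = 1, and the second family makes N the upper shift. *)
Lemma jordan_gram_polarized : has_jordan_gram f (fun i => 2 * r i)%N ->
  \dim {:V} = (2 * \sum_i r i)%N /\
  exists e o, polarized f (jordan_sum F r)^T e o.
Proof.
case=> b [b_basis b_gram]; split.
  by rewrite -(span_basis b_basis) (eqnP (basis_free b_basis)) size_tuple big_distrr.
have lt0 i (k : 'I_(r i)) : (2 * k < 2 * r i)%N by rewrite ltn_pmul2l.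
have lt1 i (k : 'I_(r i)) : ((2 * k).+1 < 2 * r i)%N.
  by have := ltn_ord k; lia.
pose ei (s : 'I_(\sum_i r i)%N) : 'I_(\sum_i 2 * r i)%N :=
  tagnat.Rank (tagnat.sig1 s) (Ordinal (lt0 _ (tagnat.sig2 s))).
pose oi (s : 'I_(\sum_i r i)%N) : 'I_(\sum_i 2 * r i)%N :=
  tagnat.Rank (tagnat.sig1 s) (Ordinal (lt1 _ (tagnat.sig2 s))).
pose e s := tnth b (ei s); pose o s := tnth b (oi s).
have fb i j (x : 'I_(2 * r i)) (y : 'I_(2 * r j)) :
    f (tnth b (tagnat.Rank i x)) (tnth b (tagnat.Rank j y)) =
    ((i == j) && (x == y.+1 :> nat))%:R.
  have /matrixP/(_ (tagnat.Rank i x) (tagnat.Rank j y)) := b_gram.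
  rewrite mxE => ->; rewrite -/(jordan_sum F _) jordan_sumE.
  have sig2V (l : 'I_t) (z : 'I_(2 * r l)) :
      tagnat.sig2 (@tagnat.Rank t (fun i => 2 * r i)%N l z) = z :> nat.
    by rewrite tagnat.Rank2K.
  by rewrite !sig2V !tagnat.Rank1K.
have eqV s s' : (s == s') = (tagnat.sig1 s == tagnat.sig1 s') &&
    (tagnat.sig2 s == tagnat.sig2 s' :> nat).
  by rewrite -[s in LHS]tagnat.sig2K -[s' in LHS]tagnat.sig2K -tagnat.eq_Rank.
have fee s s' : f (e s) (e s') = 0.
  by rewrite fb /= [X in _ && X](_ : _ = false) ?andbF //; lia.
have foo s s' : f (o s) (o s') = 0.
  by rewrite fb /= [X in _ && X](_ : _ = false) ?andbF //; lia.
have foe s s' : f (o s) (e s') = (s == s')%:R.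
  by rewrite fb /= eqV; congr (_ && _)%:R; lia.
have feo s s' : f (e s) (o s') = (jordan_sum F r)^T s' s.
  by rewrite fb tr_jordan_sumE /=; congr (_ && _)%:R; lia.
exists e, o; split=> // v.
(* With c = 1 and the identity matrix, gl_polar sends v to the claimed
   expansion of v; being linear, it is the identity if it fixes a basis. *)
have resE s : gl_polar f e o 1 1%:M (e s) = e s.
  rewrite /gl_polar /recombine mul1mx trmx1 mul1mx scale1r.
  rewrite (bigD1 s) //= mxE foe eqxx scale1r !big1 ?addr0 // => s'.
    by rewrite mxE fee scale0r.
  by rewrite mxE foe => /negPf->; rewrite scale0r.
have resO s : gl_polar f e o 1 1%:M (o s) = o s.
  rewrite /gl_polar /recombine mul1mx trmx1 mul1mx scale1r addrC.
  rewrite (bigD1 s) //= mxE foe eqxx scale1r !big1 ?addr0 // => s'.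
    by rewrite mxE foo scale0r.
  by rewrite mxE foe eq_sym => /negPf->; rewrite scale0r.
have resb j : gl_polar f e o 1 1%:M (tnth b j) = tnth b j.
  pose k := tagnat.sig2 j; have lk : (k./2 < r (tagnat.sig1 j))%N.
    by have := ltn_ord k; lia.
  pose s : 'I_(\sum_i r i)%N := tagnat.Rank (tagnat.sig1 j) (Ordinal lk).
  (* Position 2k of a block carries e_k and position 2k + 1 carries o_k. *)
  have [jE|jO] : j = ei s \/ j = oi s.
  - have vs : tagnat.sig2 s = k./2 :> nat by rewrite tagnat.Rank2K.
    have es : tagnat.sig1 s = tagnat.sig1 j by rewrite tagnat.Rank1K.
    have jR (i : 'I_t) (x : 'I_(2 * r i)) :
        i = tagnat.sig1 j -> x = k :> nat -> j = tagnat.Rank i x.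
      move=> ij xk; rewrite -[j in LHS]tagnat.sig2K; apply/val_inj/eqP.
      by rewrite tagnat.eq_Rank; apply/andP; split; apply/eqP; rewrite ?xk ?ij.
    have [ko|ke] := boolP (odd k); [right|left]; apply: jR => //=;
      by rewrite vs mul2n -[RHS]odd_double_half ?ko ?(negPf ke).
  - by rewrite jE; apply: resE.
  - by rewrite jO; apply: resO.
transitivity (gl_polar f e o 1 1%:M v).
  rewrite (coord_basis b_basis (memvf v)) linear_sum; apply: eq_bigr => i _.
  by rewrite linearZ /= -tnth_nth resb.
rewrite /gl_polar /recombine mul1mx trmx1 mul1mx scale1r.
by congr (_ + _); apply: eq_bigr => i _; rewrite mxE.
Qed.
End JordanPolarization.

(** * Centralizers of nilpotent matrices with several Jordan blocks *)

Section SquareZeroIdeal.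
Variables (F : fieldType) (n : nat) (N : 'M[F]_n).

(** The A in C(N) that vanish on the image of N and on its kernel; vanishing on
    the kernel is the same as being a left multiple of N. *)
Definition sandwich_ideal : {vspace 'M[F]_n} :=
  (lie_centralizer N :&: lker (linfun (mulmx N))
     :&: lker (linfun (mulmxr (cokermx N))))%VS.

Lemma mem_sandwich_ideal (A : 'M[F]_n) : reflect
  [/\ A *m N = N *m A, N *m A = 0 & (A <= N)%MS] (A \in sandwich_ideal).
Proof.
rewrite 2!memv_cap mem_centralizer_mx !memv_ker !lfunE /= submxE.
by apply: (iffP andP) => [[/andP[/eqP -> /eqP ->]] | [-> -> ->]]; rewrite ?eqxx.
Qed.

Lemma sandwich_ideal_ideal : lie_ideal (lie_centralizer N) sandwich_ideal.
Proof.
split=> [|B A].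
  by apply/subvP => A /mem_sandwich_ideal[AN _ _]; rewrite mem_centralizer_mx AN.
rewrite mem_centralizer_mx => /eqP BN /mem_sandwich_ideal[AN NA sAN].
apply/mem_sandwich_ideal; rewrite lie_mxE.
have N0 : N *m (B *m A - A *m B) = 0.
  by rewrite mulmxBr !mulmxA -BN NA -mulmxA NA mulmx0 mul0mx subrr.
split=> //.
  by rewrite N0 mulmxBl -!mulmxA BN AN NA mulmx0 (mulmxA A) AN NA mul0mx subrr.
case/submxP: sAN => D ->.
by rewrite -[D *m N *m B]mulmxA -BN !mulmxA -mulmxBl submxMl.
Qed.

(** If A = D N and N B = 0 then A B = 0: all products in the ideal vanish. *)
Lemma sandwich_ideal_solvable : lie_solvable sandwich_ideal.
Proof.
exists 1%N; apply/eqP; rewrite -subv0 /=; apply/liev_subP => A B.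
move=> /mem_sandwich_ideal[_ NA /submxP[D AD]] /mem_sandwich_ideal[_ NB /submxP[E BE]].
by rewrite memv0 lie_mxE {1}AD {2}BE -!mulmxA NA NB !mulmx0 subrr.
Qed.

End SquareZeroIdeal.

Section JordanCentralizer.
Variables (F : fieldType) (t : nat) (r : 'I_t -> nat).
Local Notation N := (jordan_sum F r)^T.
Hypothesis r_gt0 : forall i, (0 < r i)%N.

Definition block_proj i : 'M[F]_(\sum_i r i) :=
  diag_mx (\row_s (tagnat.sig1 s == i)%:R).

Lemma block_proj_idem i : block_proj i *m block_proj i = block_proj i.
Proof.
rewrite /block_proj mulmx_diag; congr diag_mx; apply/rowP => s.
by rewrite !mxE -natrM mulnb andbb.
Qed.

Lemma block_proj_comm i : block_proj i *m N = N *m block_proj i.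
Proof.
rewrite /block_proj mul_diag_mx mul_mx_diag; apply/matrixP => s s'.
rewrite [LHS]mxE [RHS]mxE !tr_jordan_sumE ![(\row__ _) _ _]mxE.
case: (eqVneq (tagnat.sig1 s') (tagnat.sig1 s)) => [ss'|_].
  by rewrite mulrC; congr (_ * (_ == i)%:R).
by rewrite mul0r mulr0.
Qed.

Lemma block_proj_Rank i j (k : 'I_(r j)) :
  block_proj i (tagnat.Rank j k) (tagnat.Rank j k) = (j == i)%:R.
Proof. by rewrite !mxE eqxx mulr1n tagnat.Rank1K. Qed.

Lemma jordan_centralizer_idem (i j : 'I_t) : i != j ->
  exists A : 'M[F]_(\sum_i r i), [/\ A *m A = A, A *m N = N *m A, A <> 0 & A <> 1%:M].
Proof.
move=> ij; exists (block_proj i); split.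
- exact: block_proj_idem.
- exact: block_proj_comm.
- pose s := tagnat.Rank i (Ordinal (r_gt0 i)); move=> /matrixP/(_ s s)/eqP.
  by rewrite block_proj_Rank mxE eqxx oner_eq0.
- pose s := tagnat.Rank j (Ordinal (r_gt0 j)); move=> /matrixP/(_ s s)/eqP.
  by rewrite block_proj_Rank mxE eqxx eq_sym [j == i]eq_sym (negPf ij) oner_eq0.
Qed.

(** The witness in the ideal is the elementary matrix E_(s2, s1), with s1 the
    last index of block i and s2 the first index of block j.  It is written
    E_(s2, s') N, with s' the index before s1, to display it as a left multiple
    of N; here block i must have size at least 2. *)
Lemma jordan_centralizer_not_reductive (i j : 'I_t) : i != j -> (1 < r i)%N ->
  ~ lie_reductive (lie_centralizer N).
Proof.
move=> ij ri_gt1 redN.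
have l1 : ((r i).-2 < r i)%N by lia.
have l2 : ((r i).-1 < r i)%N by lia.
have sig2V (l : 'I_t) (z : 'I_(r l)) :
  (tagnat.sig2 (@tagnat.Rank t r l z) : nat) = z by rewrite tagnat.Rank2K.
pose s1 := tagnat.Rank i (Ordinal l2); pose s' := tagnat.Rank i (Ordinal l1).
pose s2 := tagnat.Rank j (Ordinal (r_gt0 j)).
pose A := delta_mx s2 s' *m N.
have NE : N *m delta_mx s2 s' = 0.
  apply/matrixP => p q; rewrite [LHS]mxE [RHS]mxE big1 // => u _.
  rewrite tr_jordan_sumE mxE.
  case: (u =P s2) => [->|]; last by rewrite mulr0.
  by rewrite sig2V andbF mul0r.
have ENN : delta_mx s2 s' *m N *m N = 0.
  apply/matrixP => p q; rewrite -mulmxA [LHS]mxE [RHS]mxE big1 // => u _; rewrite mxE.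
  case: (u =P s') => [->|]; last by rewrite andbF mul0r.
  rewrite [X in _ * X]mxE [X in _ * X]big1 ?mulr0 // => w _.
  rewrite !tr_jordan_sumE sig2V.
  case: eqP => [hs|]; last by rewrite mul0r.
  case: eqP => [hw|]; last by rewrite mul0r.
  case: eqP => [hq|]; last by rewrite mulr0.
  case: eqP => [hv|]; last by rewrite mulr0.
  have := ltn_ord (tagnat.sig2 q); rewrite hv hw /= hq hs tagnat.Rank1K; lia.
have IA : A \in sandwich_ideal N.
  by apply/mem_sandwich_ideal; rewrite /A ENN !mulmxA NE mul0mx submxMl.
have CB : block_proj i \in lie_centralizer N.
  by rewrite mem_centralizer_mx block_proj_comm.
have := redN _ (sandwich_ideal_ideal N) (sandwich_ideal_solvable N) _ _ CB IA.
rewrite lie_mxE /A -[_ *m block_proj i]mulmxA -block_proj_comm !mulmxA.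
have -> : delta_mx s2 s' *m block_proj i = delta_mx s2 s'.
  rewrite mul_mx_diag; apply/matrixP => p q; rewrite !mxE.
  by case: (q =P s') => [->|]; rewrite ?tagnat.Rank1K ?eqxx ?mulr1 // andbF mul0r.
have -> : block_proj i *m delta_mx s2 s' = 0.
  rewrite mul_diag_mx; apply/matrixP => p q; rewrite !mxE.
  case: (p =P s2) => [->|]; last by rewrite mulr0.
  by rewrite tagnat.Rank1K eq_sym (negPf ij) mul0r.
rewrite mul0mx sub0r => /eqP; rewrite oppr_eq0 => /eqP/matrixP/(_ s2 s1)/eqP.
rewrite [X in _ == X]mxE mxE (bigD1 s') //= [X in _ + X]big1 => [|u us']; last first.
  by rewrite mxE (negPf us') andbF mul0r.
rewrite tr_jordan_sumE mxE !eqxx mul1r addr0 !sig2V !tagnat.Rank1K eqxx /=.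
have -> : ((r i).-1 = (r i).-2.+1)%N by lia.
by rewrite eqxx /= oner_eq0.
Qed.

End JordanCentralizer.

(** * The centralizer of a single Jordan block *)

Section SingleBlock.
Variables (F : fieldType) (n : nat) (N : 'M[F]_n.+1).
Hypothesis NE : forall i j, N i j = (j == i.+1 :> nat)%:R.
Implicit Types (A : 'M[F]_n.+1).

Lemma shift_expE k i j : (N ^+ k) i j = (j == (i + k)%N :> nat)%:R.
Proof.
elim: k i => [|k IHk] i; first by rewrite mxE addn0 eq_sym.
rewrite exprS -mulmxE mxE; case: (ltnP i.+1 n.+1) => [lti | gei].
  rewrite (bigD1 (Ordinal lti)) //= NE eqxx mul1r IHk addSnnS big1 ?addr0 // => u.
  by rewrite NE -val_eqE /= => /negPf->; rewrite mul0r.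
rewrite big1 => [|u _]; last first.
  by rewrite NE ltn_eqF ?mul0r // (leq_trans (ltn_ord u)).
by rewrite ltn_eqF // (leq_trans (ltn_ord j)) // addnS (leq_trans gei) // ltnS leq_addr.
Qed.

Definition shift_poly (v : 'rV[F]_n.+1) : 'M[F]_n.+1 :=
  \sum_(k < n.+1) v 0 k *: N ^+ k.

Lemma row0_shift_poly v : row 0 (shift_poly v) = v.
Proof.
apply/rowP => j; rewrite mxE summxE (bigD1 j) //= mxE shift_expE eqxx mulr1.
rewrite big1 ?addr0 // => k kj.
by rewrite mxE shift_expE val_eqE eq_sym (negPf kj) mulr0.
Qed.

Lemma shift_poly_comm A v :
  A *m N = N *m A -> A *m shift_poly v = shift_poly v *m A.
Proof.
move=> AN; apply: comm_mx_sum => k _.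
by rewrite /comm_mx -scalemxAl -scalemxAr; congr (_ *: _); apply: commrX.
Qed.

Lemma comm_shiftS A (i j i' j' : 'I_n.+1) : A *m N = N *m A ->
  i' = i.+1 :> nat -> j' = j.+1 :> nat -> A i' j' = A i j.
Proof.
move=> AN i'E j'E; have /matrixP/(_ i j') := AN.
rewrite !mxE (bigD1 j) //= [in RHS](bigD1 i') //= !NE i'E j'E !eqxx mul1r mulr1.
rewrite !big1 ?addr0 => [->|k|k] //; rewrite -val_eqE NE /= ?i'E ?j'E ?eqSS.
  by move/negPf->; rewrite mul0r.
by rewrite eq_sym => /negPf->; rewrite mulr0.
Qed.

Lemma comm_shift0 A i' : A *m N = N *m A -> i' != 0 -> A i' 0 = 0.
Proof.
move=> AN i'0; have lti : (i'.-1 < n.+1)%N by rewrite (leq_ltn_trans (leq_pred _)).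
have i'E : i' = i'.-1.+1 :> nat by rewrite prednK // lt0n.
have /matrixP/(_ (Ordinal lti) 0) := AN.
rewrite !mxE [in RHS](bigD1 i') //= NE -i'E eqxx mul1r big1; last first.
  by move=> k _; rewrite NE mulr0.
rewrite big1 ?addr0 // => k; rewrite -val_eqE NE /= -i'E.
by move/negPf->; rewrite mul0r.
Qed.

(** Commuting with the shift makes A constant along its diagonals and zero below
    the main one: an upper triangular Toeplitz matrix. *)
Lemma comm_shift_trig A (i j : 'I_n.+1) : A *m N = N *m A ->
  A i j = if (i <= j)%N then A 0 (inord (j - i)) else 0.
Proof.
move=> AN; have [k] := ubnP i; elim: k i j => // k IHk i j lik.
have [i0|i_neq0] := eqVneq i 0.
  by rewrite i0 subn0 inord_val.
have i_gt0 : (0 < i)%N by rewrite lt0n.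
have [j0|j_neq0] := eqVneq j 0.
  by rewrite j0 comm_shift0 // leqNgt i_gt0.
have j_gt0 : (0 < j)%N by rewrite lt0n.
have li : (i.-1 < n.+1)%N by rewrite (leq_ltn_trans (leq_pred _)).
have lj : (j.-1 < n.+1)%N by rewrite (leq_ltn_trans (leq_pred _)).
rewrite (@comm_shiftS _ (Ordinal li) (Ordinal lj)) ?prednK // IHk /=; last by lia.
have -> : (i.-1 <= j.-1)%N = (i <= j)%N by lia.
by have -> : (j.-1 - i.-1 = j - i)%N by lia.
Qed.

Lemma comm_shift_inj A B : A *m N = N *m A -> B *m N = N *m B ->
  row 0 A = row 0 B -> A = B.
Proof.
move=> AN BN AB; apply/matrixP => i j.
rewrite (comm_shift_trig _ _ AN) (comm_shift_trig _ _ BN).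
by case: ifP => // _; move/rowP/(_ (inord (j - i))): AB; rewrite !mxE.
Qed.

(** A member of the centralizer is determined by its first row, and the powers
    of N have the unit vectors as first rows. *)
Lemma comm_shiftE A : A *m N = N *m A -> A = shift_poly (row 0 A).
Proof.
move=> AN; apply: comm_shift_inj; rewrite ?row0_shift_poly //.
by apply/esym/shift_poly_comm.
Qed.

Lemma shift_poly_linear : linear shift_poly.
Proof.
move=> a u v; rewrite /shift_poly scaler_sumr -big_split /=.
by apply: eq_bigr => k _; rewrite !mxE scalerDl scalerA.
Qed.

HB.instance Definition _ := GRing.isLinear.Build F 'rV[F]_n.+1 'M[F]_n.+1 _
  shift_poly shift_poly_linear.

Lemma shift_centralizer_abelian : lie_abelian (lie_centralizer N).
Proof.
move=> A B; rewrite !mem_centralizer_mx => /eqP AN /eqP BN.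
by rewrite lie_mxE (comm_shiftE BN) shift_poly_comm // subrr.
Qed.

Lemma shift_centralizer_dim : \dim (lie_centralizer N) = n.+1.
Proof.
have -> : lie_centralizer N = limg (linfun shift_poly).
  apply/vspaceP => A; rewrite mem_centralizer_mx; apply/eqP/memv_imgP.
    by move=> AN; exists (row 0 A); rewrite ?memvf // lfunE /= -comm_shiftE.
  by case=> v _ ->; rewrite lfunE /=; apply/esym/shift_poly_comm.
rewrite limg_dim_eq ?dimvf /dim /= ?mul1n //.
apply/eqP; rewrite -subv0; apply/subvP => v /memv_capP[_].
rewrite memv_ker lfunE /= memv0 => /eqP v0.
by rewrite -[v]row0_shift_poly v0 linear0.
Qed.

(** An upper triangular Toeplitz matrix is invertible as soon as its diagonal
    entry is nonzero, and an invertible idempotent is 1.  One of A and 1 - A has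
    a nonzero diagonal. *)
Lemma shift_centralizer_idem A : A *m A = A -> A *m N = N *m A ->
  A = 0 \/ A = 1%:M.
Proof.
have id1 B : B *m B = B -> B *m N = N *m B -> B 0 0 != 0 -> B = 1%:M.
  move=> BB BN B0; have B_unit : B \in unitmx.
    rewrite unitmxE -det_tr det_trig; last first.
      by apply/is_trig_mxP => i j ij; rewrite mxE comm_shift_trig // leqNgt ij.
    rewrite unitfE; apply/prodf_neq0 => i _.
    rewrite mxE comm_shift_trig // leqnn subnn.
    by have -> : inord 0 = 0 :> 'I_n.+1 by apply: val_inj; rewrite /= inordK.
  by rewrite -(mulKmx B_unit B) BB mulVmx.
move=> AA AN; have [A0|A0] := eqVneq (A 0 0) 0; [left | by right; apply: id1].
have: 1%:M - A = 1%:M.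
  apply: id1.
  - by rewrite mulmxBr mulmx1 mulmxBl mul1mx AA subrr subr0.
  - by rewrite mulmxBl mulmxBr mulmx1 mul1mx AN.
  - by rewrite !mxE eqxx A0 subr0 oner_eq0.
by move/eqP; rewrite subr_eq -subr_eq0 opprD addNKr oppr_eq0 => /eqP.
Qed.

End SingleBlock.

(** * Reductivity of the Lie algebra of the form *)

Lemma single_block_centralizer (F : fieldType) (r : 'I_1 -> nat)
    (N := (jordan_sum F r)^T) : (0 < \sum_i r i)%N ->
  [/\ lie_abelian (lie_centralizer N), \dim (lie_centralizer N) = (\sum_i r i)%N
    & forall A, A *m A = A -> A *m N = N *m A -> A = 0 \/ A = 1%:M].
Proof.
have NE s s' : N s s' = (s' == s.+1 :> nat)%:R.
  have sig2E (u : 'I_(\sum_i r i)%N) : (tagnat.sig2 u : nat) = u.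
    by rewrite [RHS]tagnat.rect big_pred0 // => i; rewrite !ord1.
  by rewrite tr_jordan_sumE !sig2E !ord1 eqxx.
move: (\sum_i r i)%N N NE => [|n] // N NE _; split.
- exact: shift_centralizer_abelian NE.
- exact: shift_centralizer_dim NE.
- exact: shift_centralizer_idem NE.
Qed.

(** Blocks of size 1 give N = 0. *)
Lemma J2_sum_isog_gl (F : fieldType) (V : vectType F) (f : {biscalar V}) m :
  has_jordan_gram f (fun _ : 'I_m => 2%N) -> lie_isog (Lf f) {: 'M[F]_m}%VS.
Proof.
move=> gram; pose r (_ : 'I_m) := 1%N.
have [_ [e [o fP]]] := @jordan_gram_polarized F V f m r gram.
have := Lf_isog_centralizer fP (jordan_sum_nilpotent F r).
have: (jordan_sum F r)^T = 0.
  apply/matrixP => s s'; rewrite tr_jordan_sumE mxE.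
  by rewrite (ord1 (tagnat.sig2 s')) andbF.
move: (_^T); have -> : (\sum_i r i)%N = m by rewrite sum1_card card_ord.
move=> _ ->; suff -> : lie_centralizer (0 : 'M[F]_m) = fullv by [].
by apply/vspaceP => A; rewrite mem_centralizer_mx mulmx0 mul0mx eqxx memvf.
Qed.

Lemma ord_neq t (i : 'I_t.+2) : exists j, j != i.
Proof.
by have [->|i0] := eqVneq i 0; [exists ord_max | exists 0; rewrite eq_sym].
Qed.

(* The equivalence is guarded: when F has characteristic 2 and f has Gram
   matrix J_2 (+) J_2, L(f) is isomorphic to gl(2), which is then solvable and
   not abelian, hence not reductive. *)
Theorem proposition5p3 (F : fieldType) (V : vectType F) (f : {biscalar V})
    (m : nat) (V_neq0 : (0 < \dim {:V})%N) (f_even : form_even f)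
    (m_def : m = (\dim {:V})./2) :
  [/\ ~ (2%N \in [pchar F] /\ m = 2%N) ->
        (lie_reductive (Lf f) <->
           indecomposable f
           \/ ((1 < m)%N /\ has_jordan_gram f (fun _ : 'I_m => 2%N))),
      indecomposable f -> lie_abelian (Lf f) /\ \dim (Lf f) = m
    & (1 < m)%N /\ has_jordan_gram f (fun _ : 'I_m => 2%N) ->
        lie_isog (Lf f) {: 'M[F]_m}%VS].
Proof.
have [t [r [r_gt0 gram]]] := f_even.
have [dimV [e [o fP]]] := jordan_gram_polarized gram.
have N_nil := jordan_sum_nilpotent F r.
have iso := Lf_isog_centralizer fP N_nil.
have idemP := indecomposable_idem fP N_nil.
have m_sum : m = (\sum_i r i)%N by rewrite m_def dimV mul2n doubleK.
have indec_abelian : indecomposable f -> lie_abelian (Lf f) /\ \dim (Lf f) = m.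
  case: t => [|[|t]] in r r_gt0 gram dimV e o fP N_nil iso idemP m_sum *.
  - by move: V_neq0; rewrite dimV big_ord0.
  - have [|ab dimC _] := @single_block_centralizer F r.
      by rewrite big_ord1.
    move=> _; split; first exact: lie_isog_abelian (@Lf_subalg _ _ f) iso ab.
    by rewrite (lie_isog_dim iso) dimC.
  - move=> /idemP idem; have [j j0] := ord_neq (0 : 'I_t.+2).
    have [A [AA AN A0 A1]] := jordan_centralizer_idem F r_gt0 j0.
    by case: (idem A AA AN).
split=> [guard | // | [_]]; last exact: J2_sum_isog_gl.
split=> [red | [/indec_abelian[ab _] | [m_gt1 gram2]]]; last first.
- apply: lie_isog_reductive (J2_sum_isog_gl gram2) _; apply: gl_reductive.
  case: (ltnP 2 m) => [|m_le2]; [by left | right; apply/negP => two0].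
  by apply: guard; split; [rewrite inE | apply/eqP; rewrite eqn_leq m_le2].
- exact: abelian_reductive.
case: t => [|[|t]] in r r_gt0 gram dimV e o fP N_nil iso idemP m_sum *.
- by move: V_neq0; rewrite dimV big_ord0.
- left; apply/idemP; have [|//] := @single_block_centralizer F r.
  by rewrite big_ord1.
have [/forallP r1 | ] := boolP [forall i, r i == 1%N].
  right; have rE : r = fun=> 1%N.
    by apply: functional_extensionality => i; apply/eqP.
  have mE : m = t.+2 by rewrite m_sum rE sum1_card card_ord.
  by rewrite mE; split=> //; rewrite rE in gram.
rewrite negb_forall => /existsP[i ri]; have [j ji] := ord_neq i.
have ri_gt1 : (1 < r i)%N by rewrite ltn_neqAle eq_sym ri r_gt0.
rewrite eq_sym in ji.
case: (jordan_centralizer_not_reductive (F := F) r_gt0 ji ri_gt1).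
exact: lie_isog_reductive (lie_isog_sym (@Lf_subalg _ _ f) iso) red.
Qed.
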